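(* Let $D$ be an integral domain and let $\star$ be a nontrivial semistar operation on $D$. A valuation overring $V$ of $D$ is a $\tilde{\star}$-valuation overring of $D$ if and only if $V$ is an overring of $D_P$ for some $P \in \mathcal{M}(\star_f)$.
   Context: $D$ is an integral domain with quotient field $K$; an overring is a ring between $D$ and $K$. $\overline{\boldsymbol{F}}(D)$ is the set of nonzero $D$-submodules of $K$, and $\boldsymbol{f}(D)$ the set of nonzero finitely generated $D$-submodules of $K$. A semistar operation of $D$ is a map $\star : \overline{\boldsymbol{F}}(D) \to \overline{\boldsymbol{F}}(D)$, $E \mapsto E^\star$, such that for all $0 \neq z \in K$ and all $E, F \in \overline{\boldsymbol{F}}(D)$: $(zE)^\star = zE^\star$; $E \subseteq F \Rightarrow E^\star \subseteq F^\star$; $E \subseteq E^\star$ and $(E^\star)^\star = E^\star$. It is trivial if $E^\star = K$ for all $E$ (equivalently $D^\star = K$), and nontrivial otherwise. $E^{\star_f} := \bigcup\{F^\star \mid F \subseteq E,\ F \in \boldsymbol{f}(D)\}$. A quasi-$\star_f$-ideal of $D$ is a nonzero ideal $I \subseteq D$ with $I^{\star_f} \cap D = I$; $\mathcal{M}(\star_f)$ denotes the set of maximal elements of the set of all proper quasi-$\star_f$-ideals of $D$ (these are prime ideals). With $\Pi^{\star_f} := \{P \in \mathrm{Spec}(D) \mid P \neq 0,\ P^{\star_f} \cap D \neq D\}$ (nonempty for $\star$ nontrivial), $\tilde{\star} := (\star_f)_{sp}$ is the semistar operation $E^{\tilde{\star}} := \bigcap\{ED_P \mid P \in \Pi^{\star_f}\}$;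 one has $E^{\tilde{\star}} = \bigcap\{ED_Q \mid Q \in \mathcal{M}(\star_f)\}$. For a semistar operation $\ast$ of $D$, a $\ast$-valuation overring of $D$ is a valuation overring $V$ of $D$ (the field $K$ being allowed) such that $F^\ast \subseteq FV$ for each $F \in \boldsymbol{f}(D)$. *)

(* Defs.v *)
From HB Require Import structures.
From mathcomp Require Import all_boot all_order all_algebra.
From mathcomp Require Import boolp classical_sets.

Set Implicit Arguments.
Unset Strict Implicit.
Unset Printing Implicit Defensive.

Import GRing.Theory.
Local Open Scope classical_set_scope.
Local Open Scope ring_scope.

(* Ideals of D are subsets of the type D; D-submodules of the quotient field
   and overrings of D are subsets of {fraction D}, in which D is embedded by
   the injective ring morphism x |-> x%:F. *)

Section Semistar.
Variable D : idomainType.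
Local Notation K := {fraction D}.
Local Notation "x %:F" := (@FracField.tofrac D x) (only parsing).

Implicit Types (E F V : set K) (I J P : set D).

Definition extend I : set K := [set a%:F | a in I].
Definition contract E : set D := [set a | E a%:F].

Definition is_submodule E : Prop :=
  zmod_closed [in E] /\ forall (a : D) x, E x -> E (a%:F * x).

Definition Fbar E : Prop := is_submodule E /\ exists2 x, E x & x != 0.

Definition dspan n (g : 'I_n -> K) : set K :=
  [set x | exists c : 'I_n -> D, x = \sum_(i < n) (c i)%:F * g i].

Definition fbold E : Prop :=
  Fbar E /\ exists n (g : 'I_n -> K), E = dspan g.

(* The product EF of modules: all finite sums of products, not just the
   set of products. *)
Definition mulmod E F : set K :=
  [set x | exists n (a b : 'I_n -> K),
     [/\ forall i, E (a i), forall i, F (b i) & x = \sum_(i < n) a i * b i]].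

Definition scale (z : K) E : set K := [set z * x | x in E].

(* A map from Fbar to itself is given by a function on all subsets of the
   quotient field whose values outside Fbar are junk: they are constrained by
   no axiom and used in no definition below. *)
Record semistar := Semistar {
  semistar_fun :> set K -> set K;
  semistar_Fbar : forall E, Fbar E -> Fbar (semistar_fun E);
  semistar_scale : forall (z : K) E, z != 0 -> Fbar E ->
    semistar_fun (scale z E) = scale z (semistar_fun E);
  semistar_mono : forall E F, Fbar E -> Fbar F -> E `<=` F ->
    semistar_fun E `<=` semistar_fun F;
  semistar_ext : forall E, Fbar E -> E `<=` semistar_fun E;
  semistar_idem : forall E, Fbar E ->
    semistar_fun (semistar_fun E) = semistar_fun E
}.

Implicit Types star : semistar.

Definition trivial_semistar star : Prop :=
  forall E, Fbar E -> star E = setT.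

Definition star_f star : set K -> set K := fun E =>
  [set x | exists F, [/\ fbold F, F `<=` E & star F x]].

Definition is_ideal I : Prop :=
  zmod_closed [in I] /\ forall a x, I x -> I (a * x).

(* idealr_closed already excludes the unit ideal. *)
Definition is_prime_ideal P : Prop :=
  idealr_closed [in P] /\ prime_idealr_closed [in P].

Definition nonzero_ideal I : Prop := exists2 a, I a & a != 0.

Definition quasi_star_f_ideal star I : Prop :=
  [/\ is_ideal I, nonzero_ideal I & contract (star_f star (extend I)) = I].

Definition proper_quasi_star_f_ideal star I : Prop :=
  quasi_star_f_ideal star I /\ I <> setT.

Definition max_star_f star : set (set D) :=
  [set P | proper_quasi_star_f_ideal star P /\
    forall J, proper_quasi_star_f_ideal star J -> P `<=` J -> J = P].

Definition localization P : set K :=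
  [set x | exists a s : D, ~ P s /\ x = a%:F / s%:F].

Definition Pi_star_f star : set (set D) :=
  [set P | [/\ is_prime_ideal P, nonzero_ideal P &
    contract (star_f star (extend P)) <> setT]].

Definition star_tilde star : set K -> set K := fun E =>
  [set x | forall P, Pi_star_f star P -> mulmod E (localization P) x].

Definition overring (A V : set K) : Prop :=
  subring_closed [in V] /\ A `<=` V.

(* V may be the whole quotient field. *)
Definition valuation_overring V : Prop :=
  overring (extend setT) V /\ forall x : K, x != 0 -> V x \/ V x^-1.

Definition star_valuation_overring (op : set K -> set K) V : Prop :=
  valuation_overring V /\ forall F, fbold F -> op F `<=` mulmod F V.

End Semistar.

(* Main.v *)
Require Import Defs.
From mathcomp Require Import all_boot all_algebra.
From mathcomp Require Import classical_sets.
From mathcomp Require Import boolp.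

(** The finite-type closure star_f turns the condition 1 \in E^star_f into a
    condition on finitely many elements of E.  This makes star_f idempotent and
    compatible with unions of chains, so that by Zorn's lemma every nonzero
    ideal I with 1 \notin I^star_f lies in some P in M(star_f)
    ([exists_max_star_f]); such a P is prime, since (P : a) is again a
    quasi-star_f-ideal ([max_star_f_prime]).  Nontriviality of star provides at
    least one P ([max_star_f_exists]).

    If V contains D_P with P in M(star_f), then P is one of the primes that
    define star_tilde, and F^star_tilde is contained in F D_P, hence in F V.

    Conversely, let C be the center of V on D, that is, the contraction of the
    ideal M of nonunits of V.  Elements of D outside C are invertible in V, so
    V contains D_P as soon as P contains C ([localization_sub]).  If C = 0, any
    P in M(star_f) will do.  Otherwise such a P exists unless 1 \in C^star_f.
    In that case 1 \in F^star for a finitely generated F contained in C.  No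
    prime Q of Pi_star_f contains this F, whence 1 \in F D_Q for all of them,
    i.e. 1 \in F^star_tilde ([star_tilde_one]).  For a star_tilde-valuation
    overring this gives 1 \in F V, which is contained in M: a contradiction. *)

Set Implicit Arguments.
Unset Strict Implicit.
Unset Printing Implicit Defensive.

Import GRing.Theory.
Local Open Scope classical_set_scope.
Local Open Scope ring_scope.

Section SemistarTheory.
Variable D : idomainType.
Local Notation K := {fraction D}.
Local Notation "x %:F" := (@FracField.tofrac D x).

Implicit Types (E F G V : set K) (I J P : set D) (star : semistar D).

(** * Submodules of the quotient field and ideals *)

Lemma fractionE (x : K) : exists a b : D, b != 0 /\ x = a%:F / b%:F.
Proof.
elim/quotW: x => r; exists (\n_r), (\d_r); split; first exact: denom_ratioP.
have d0 : (\d_r)%:F != 0 :> K by rewrite tofrac_eq0 denom_ratioP.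
apply: (mulIf d0); rewrite divfK //.
unlock FracField.tofrac; rewrite -[LHS]FracField.pi_mul.
rewrite -[RHS]/(\pi_(FracField.type D) (Ratio \n_r 1))%qT.
apply/eqmodP; rewrite /= FracField.equivfE /FracField.mulf.
by rewrite !numden_Ratio ?mulf_neq0 ?denom_ratioP ?oner_neq0 // !mulr1 mulrC.
Qed.

Lemma submoduleP E : is_submodule E <->
  [/\ E 0, forall x y, E x -> E y -> E (x + y)
         & forall (a : D) x, E x -> E (a%:F * x)].
Proof.
split=> [[[E0 EB] EM]|[E0 ED EM]].
  have {}E0 : E 0 by exact: set_mem.
  have {}EB x y : E x -> E y -> E (x - y).
    by move=> Ex Ey; apply: set_mem; apply: EB; exact: mem_set.
  split=> // x y Ex Ey; have := EB _ _ Ex (EB _ _ E0 Ey).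
  by rewrite sub0r opprK.
split=> //; split=> [|x y /set_mem Ex /set_mem Ey]; apply: mem_set => //.
apply: ED => //; have := EM (- 1) _ Ey.
by rewrite rmorphN rmorph1 mulN1r.
Qed.

Lemma idealP I : is_ideal I <->
  [/\ I 0, forall x y, I x -> I y -> I (x + y) & forall a x, I x -> I (a * x)].
Proof.
split=> [[[I0 IB] IM]|[I0 ID IM]].
  have {}I0 : I 0 by exact: set_mem.
  have {}IB x y : I x -> I y -> I (x - y).
    by move=> Ix Iy; apply: set_mem; apply: IB; exact: mem_set.
  split=> // x y Ix Iy; have := IB _ _ Ix (IB _ _ I0 Iy).
  by rewrite sub0r opprK.
split=> //; split=> [|x y /set_mem Ix /set_mem Iy]; apply: mem_set => //.
by apply: ID => //; have := IM (- 1) _ Iy; rewrite mulN1r.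
Qed.

Lemma ideal_unit I : is_ideal I -> I 1 -> I = setT.
Proof.
move=> [_ IM] I1; apply/seteqP; split=> // x _.
by rewrite -[x]mulr1; exact: IM.
Qed.

Lemma extendE I a : extend I a%:F <-> I a.
Proof.
split=> [[b Ib /eqP]|Ia]; last by exists a.
by rewrite tofrac_eq => /eqP <-.
Qed.

Lemma extend_sub I J : I `<=` J -> extend I `<=` extend J.
Proof. by move=> IJ _ [a /IJ Ja <-]; exists a. Qed.

Lemma extend_Fbar I : is_ideal I -> nonzero_ideal I -> Fbar (extend I).
Proof.
move=> /idealP[I0 ID IM] [a Ia a0]; split; last first.
  by exists a%:F; [exists a|rewrite tofrac_eq0].
apply/submoduleP; split; first by exists 0; rewrite ?rmorph0.
- move=> _ _ [x Ix <-] [y Iy <-].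
  by exists (x + y); rewrite ?rmorphD //; exact: ID.
- by move=> b _ [x Ix <-]; exists (b * x); rewrite ?rmorphM //; exact: IM.
Qed.

Lemma setT_ideal : is_ideal (setT : set D) /\ nonzero_ideal (setT : set D).
Proof. by split; [apply/idealP|exists 1; rewrite ?oner_eq0]. Qed.

Lemma contract_ideal E : is_submodule E -> is_ideal (contract E).
Proof.
move=> /submoduleP[E0 ED EM]; apply/idealP; rewrite /contract /=.
split=> [|x y Ex Ey|a x Ex]; rewrite ?rmorph0 ?rmorphD ?rmorphM //.
- exact: ED.
- exact: EM.
Qed.

Lemma scale_Fbar (z : K) E : z != 0 -> Fbar E -> Fbar (scale z E).
Proof.
move=> z0 [/submoduleP[E0 ED EM] [x Ex x0]]; split; last first.
  by exists (z * x); [exists x|rewrite mulf_neq0].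
apply/submoduleP; split; first by exists 0; rewrite ?mulr0.
- move=> _ _ [u Eu <-] [v Ev <-].
  by exists (u + v); rewrite ?mulrDr //; exact: ED.
- by move=> a _ [u Eu <-]; exists (a%:F * u); rewrite 1?mulrCA //; exact: EM.
Qed.

(** * Finitely generated submodules *)

Lemma dspan_gen n (g : 'I_n -> K) i : dspan g (g i).
Proof.
exists (fun j => (j == i)%:R); rewrite (bigD1 i) //= eqxx rmorph1 mul1r.
by rewrite big1 ?addr0 // => j /negbTE ->; rewrite rmorph0 mul0r.
Qed.

Lemma dspan_submodule n (g : 'I_n -> K) : is_submodule (dspan g).
Proof.
apply/submoduleP; split.
- by exists (fun=> 0); rewrite big1 // => i _; rewrite rmorph0 mul0r.
- move=> _ _ [c ->] [d ->]; exists (fun i => c i + d i); rewrite -big_split.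
  by apply: eq_bigr => i _; rewrite rmorphD mulrDl.
- move=> a _ [c ->]; exists (fun i => a * c i); rewrite big_distrr.
  by apply: eq_bigr => i _; rewrite /= rmorphM mulrA.
Qed.

Lemma submodule_sum n (f : 'I_n -> K) E :
  is_submodule E -> (forall i, E (f i)) -> E (\sum_(i < n) f i).
Proof. by move=> /submoduleP[E0 ED _] Ef; apply: big_ind. Qed.

Lemma dspan_sub n (g : 'I_n -> K) E :
  is_submodule E -> (forall i, E (g i)) -> dspan g `<=` E.
Proof.
move=> Emod Eg _ [c ->]; apply: submodule_sum => // i.
by move/submoduleP: Emod => [_ _]; apply.
Qed.

Lemma fbold_Fbar E : fbold E -> Fbar E. Proof. by case. Qed.

Lemma fbold_principal (x : K) E : is_submodule E -> E x -> x != 0 ->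
  exists F, [/\ fbold F, F `<=` E & F x].
Proof.
move=> Emod Ex x0; exists (dspan (fun _ : 'I_1 => x)).
have gx := dspan_gen (fun _ : 'I_1 => x) ord0.
split=> //; last exact: dspan_sub.
split; last by exists 1, (fun=> x).
by split; [exact: dspan_submodule|exists x].
Qed.

Lemma fbold_scale (z : K) F : z != 0 -> fbold F -> fbold (scale z F).
Proof.
move=> z0 [Fb [n [g gF]]]; split; first exact: scale_Fbar.
exists n, (fun i => z * g i); rewrite gF; apply/seteqP; split.
- move=> _ [_ [c ->] <-]; exists c; rewrite big_distrr.
  by apply: eq_bigr => i _; rewrite /= mulrCA.
- move=> _ [c ->]; exists (\sum_(i < n) (c i)%:F * g i); first by exists c.
  by rewrite big_distrr; apply: eq_bigr => i _; rewrite /= mulrCA.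
Qed.

(** The family of finitely generated submodules of E is directed upwards;
    this is what reduces finitely many memberships in E^star_f to a single
    finitely generated submodule. *)
Lemma fbold_join F G E : fbold F -> fbold G -> is_submodule E ->
  F `<=` E -> G `<=` E ->
  exists H, [/\ fbold H, H `<=` E, F `<=` H & G `<=` H].
Proof.
move=> [[_ [x Fx x0]] [m [f fF]]] [_ [n [g gG]]] Emod FE GE.
pose h (k : 'I_(m + n)) :=
  match split k with inl i => f i | inr j => g j end.
have hl i : h (lshift n i) = f i.
  by rewrite /h (unsplitK (inl _ i : 'I_m + 'I_n)%type).
have hr i : h (rshift m i) = g i.
  by rewrite /h (unsplitK (inr _ i : 'I_m + 'I_n)%type).
have Fh : F `<=` dspan h.
  rewrite fF; apply: dspan_sub => [|i]; first exact: dspan_submodule.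
  by rewrite -hl; exact: dspan_gen.
exists (dspan h); split=> //.
- split; last by exists (m + n)%N, h.
  by split; [exact: dspan_submodule|exists x => //; exact: Fh].
- apply: dspan_sub => // k; rewrite /h; case: (split k) => i.
  + by apply: FE; rewrite fF; exact: dspan_gen.
  + by apply: GE; rewrite gG; exact: dspan_gen.
- rewrite gG; apply: dspan_sub => [|i]; first exact: dspan_submodule.
  by rewrite -hr; exact: dspan_gen.
Qed.

(** Used twice: for the closures F^star of the finitely generated F inside a
    module, and for chains of ideals. *)
Lemma directed_finite T (B : set (set T)) n (g : 'I_n -> T) :
  B !=set0 ->
  (forall X Y, B X -> B Y -> exists Z, [/\ B Z, X `<=` Z & Y `<=` Z]) ->
  (forall i, exists2 X, B X & X (g i)) ->
  exists2 X, B X & forall i, X (g i).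
Proof.
move=> [X0 BX0] dirB; elim: n g => [|n IHn] g gB.
  by exists X0 => // -[].
have [X BX Xg] := IHn (fun i => g (lift ord0 i)) (fun i => gB _).
have [Y BY Yg] := gB ord0; have [Z [BZ XZ YZ]] := dirB _ _ BX BY.
exists Z => // i; case: (unliftP ord0 i) => [j ->|->]; first exact: XZ.
exact: YZ.
Qed.

(** * The finite-type closure *)

Lemma star_submodule star F : fbold F -> is_submodule (star F).
Proof. by case=> Fb _; have [] := semistar_Fbar star Fb. Qed.

Lemma star_f_sub star E F : E `<=` F -> star_f star E `<=` star_f star F.
Proof. by move=> EF x [G [Gf GE Gx]]; exists G; split=> // y /GE/EF. Qed.

Lemma star_f_ext star E : Fbar E -> E `<=` star_f star E.
Proof.
move=> [Emod [y Ey y0]] x Ex; have [x0|x0] := eqVneq x 0.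
  have [F [Ff FE _]] := fbold_principal Emod Ey y0; exists F; split=> //.
  by rewrite x0; have /submoduleP[] := star_submodule star Ff.
have [F [Ff FE Fx]] := fbold_principal Emod Ex x0; exists F; split=> //.
exact: semistar_ext (fbold_Fbar Ff) _ Fx.
Qed.

(** A common F for all the g i exists because enlarging F enlarges F^star. *)
Lemma star_f_finite star E n (g : 'I_n -> K) : Fbar E ->
  (forall i, star_f star E (g i)) ->
  exists F, [/\ fbold F, F `<=` E & forall i, star F (g i)].
Proof.
move=> [Emod [y Ey y0]] gE.
pose B := [set star F | F in [set F | fbold F /\ F `<=` E]].
have [||i|_ [F [Ff FE] <-] Fg] := @directed_finite _ B _ g.
- have [F [Ff FE _]] := fbold_principal Emod Ey y0.
  by exists (star F), F.
- move=> _ _ [F [Ff FE] <-] [G [Gf GE] <-].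
  have [H [Hf HE FH GH]] := fbold_join Ff Gf Emod FE GE.
  exists (star H); split; first by exists H.
  + by apply: semistar_mono => //; exact: fbold_Fbar.
  + by apply: semistar_mono => //; exact: fbold_Fbar.
- by have [F [Ff FE Fg]] := gE i; exists (star F) => //; exists F.
- by exists F.
Qed.

Lemma star_f_Fbar star E : Fbar E -> Fbar (star_f star E).
Proof.
move=> Eb; have [Emod [y Ey y0]] := Eb.
split; last by exists y => //; exact: star_f_ext.
apply/submoduleP; split.
- by apply: star_f_ext => //; have /submoduleP[] := Emod.
- move=> x z Ex Ez; pose g (i : 'I_2) := if i == ord0 then x else z.
  have [|F [Ff FE Fg]] := @star_f_finite star E _ g Eb.
    by move=> i; rewrite /g; case: ifP.
  exists F; split=> //; have /submoduleP[_ FD _] := star_submodule star Ff.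
  by apply: FD; [exact: Fg ord0|exact: Fg (lift ord0 ord0)].
- move=> a x [F [Ff FE Fx]]; exists F; split=> //.
  by have /submoduleP[_ _] := star_submodule star Ff; apply.
Qed.

(** Finitely many generators of a submodule of E^star_f already lie in G^star
    for one finitely generated G inside E, and star is idempotent on G. *)
Lemma star_f_idem star E : Fbar E ->
  star_f star (star_f star E) `<=` star_f star E.
Proof.
move=> Eb x [F [[Fb [n [g gF]]] FE Fx]].
have [|G [Gf GE Gg]] := @star_f_finite star E n g Eb.
  by move=> i; apply: FE; rewrite gF; exact: dspan_gen.
exists G; split=> //; rewrite -(semistar_idem star (fbold_Fbar Gf)).
move: x Fx; apply: semistar_mono => //.
  exact/semistar_Fbar/fbold_Fbar.
by rewrite gF; apply: dspan_sub => //; exact: star_submodule.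
Qed.

(** * Maximal quasi-ideals *)

Lemma proper_quasiP star I : quasi_star_f_ideal star I ->
  (I <> setT <-> ~ star_f star (extend I) 1).
Proof.
move=> [Iid I0 Iq].
have -> : star_f star (extend I) 1 <-> I 1.
  by rewrite -{2}Iq /contract /= rmorph1.
split; first by move=> IT I1; apply: IT; exact: ideal_unit.
by move=> I1 IT; apply: I1; rewrite IT.
Qed.

(** Closing an ideal under star_f and contracting yields a quasi-star_f-ideal
    in one step, and adjoins 1 to the star_f-closure only if 1 was there
    before.  Hence a maximal ideal among those with 1 outside their closure is
    its own quasi-closure. *)
Lemma quasi_closure star I : is_ideal I -> nonzero_ideal I ->
  let J := contract (star_f star (extend I)) in
  [/\ quasi_star_f_ideal star J, I `<=` J &
      star_f star (extend J) `<=` star_f star (extend I)].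
Proof.
move=> Iid I0 J; have Ib := extend_Fbar Iid I0.
have IJ : I `<=` J.
  by move=> a Ia; apply: star_f_ext => //; exists a.
have J_sub : star_f star (extend J) `<=` star_f star (extend I).
  move=> x Jx; apply: star_f_idem => //; move: Jx; apply: star_f_sub.
  by move=> _ [a Ja <-].
have Jid : is_ideal J by apply: contract_ideal; have [] := star_f_Fbar star Ib.
have J0 : nonzero_ideal J by case: I0 => a Ia a0; exists a => //; exact: IJ.
split=> //; split=> //; apply/seteqP; split=> [a|a Ja]; first exact: J_sub.
by apply: star_f_ext; [exact: extend_Fbar|exists a].
Qed.

(** A finitely generated submodule of the union of a chain is contained in a
    member of the chain; this is where star_f, as opposed to star, is needed
    for Zorn's lemma. *)
Lemma star_f_bigcup star (C : set (set D)) : C !=set0 -> total_on C subset ->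
  (forall X, C X -> is_ideal X /\ nonzero_ideal X) ->
  star_f star (extend (\bigcup_(X in C) X)) `<=`
  \bigcup_(X in C) star_f star (extend X).
Proof.
move=> [X0 CX0] Ctot Cid x [F [Ff FC Fx]]; have [_ [n [g gF]]] := Ff.
have [||i|_ [X CX <-] Xg] := @directed_finite _ [set extend X | X in C] n g.
- by exists (extend X0), X0.
- move=> _ _ [X CX <-] [Y CY <-]; have [XY|YX] := Ctot _ _ CX CY.
  + by exists (extend Y); split=> //; [exists Y|exact: extend_sub].
  + by exists (extend X); split=> //; [exists X|exact: extend_sub].
- have /FC[a [X CX Xa] <-] : F (g i) by rewrite gF; exact: dspan_gen.
  by exists (extend X); [exists X|exists a].
exists X => //; exists F; split=> //; rewrite gF; apply: dspan_sub => //.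
by have [Xid X_neq0] := Cid X CX; have [] := extend_Fbar Xid X_neq0.
Qed.

Lemma bigcup_ideal (C : set (set D)) : C !=set0 -> total_on C subset ->
  (forall X, C X -> is_ideal X) -> is_ideal (\bigcup_(X in C) X).
Proof.
move=> [X0 CX0] Ctot Cid; apply/idealP; split.
- by exists X0 => //; have /idealP[] := Cid _ CX0.
- move=> x y [X CX Xx] [Y CY Yy]; have [XY|YX] := Ctot _ _ CX CY.
  + by exists Y => //; have /idealP[_ + _] := Cid _ CY; apply => //; exact: XY.
  + by exists X => //; have /idealP[_ + _] := Cid _ CX; apply => //; exact: YX.
- move=> a x [X CX Xx]; exists X => //.
  by have /idealP[_ _] := Cid _ CX; apply.
Qed.

Lemma exists_max_star_f star I : is_ideal I -> nonzero_ideal I ->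
  ~ star_f star (extend I) 1 -> exists P, max_star_f star P /\ I `<=` P.
Proof.
move=> Iid I0 I1.
(* Being a quasi-star_f-ideal is left out of the Zorn family: it follows from
   maximality by [quasi_closure]. *)
pose good X := [/\ I `<=` X, is_ideal X & ~ star_f star (extend X) 1].
have good0 X : good X -> nonzero_ideal X.
  by case: I0 => a Ia a0 [IX _ _]; exists a => //; exact: IX.
(* The empty set is added to the family as the union of the empty chain. *)
have [C Csub Ctot|P [Pgood Pmax]] :=
    @Zorn_bigcup _ [set X | X = set0 \/ good X].
  pose C' := C `&` good.
  have CC' : \bigcup_(X in C) X = \bigcup_(X in C') X.
    apply/seteqP; split=> a [X]; last by case=> CX _ Xa; exists X.
    move=> CX Xa; exists X => //; split=> //.
    by case: (Csub _ CX) Xa => [->|].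
  have C'tot : total_on C' subset.
    by move=> X Y [CX _] [CY _]; exact: Ctot.
  rewrite /= CC'; have [->|C'0] := eqVneq C' set0.
    by left; rewrite bigcup_set0.
  move/set0P: C'0 => C'0; right; split.
  + by have [X C'X] := C'0; have [_ [IX _ _]] := C'X; move=> a /IX Xa; exists X.
  + by apply: bigcup_ideal => // X [_ []].
  + move=> /(star_f_bigcup C'0 C'tot)[X [_ Xgood]|X [_ []] //].
    by split; [case: Xgood|exact: good0].
have {Pgood} gP : good P.
  case: Pgood => // P0; case: (Pmax I); last by right; split.
  by rewrite P0; split=> // I_sub; have [a /I_sub] := I0.
have maxP J : good J -> P `<=` J -> J = P.
  move=> gJ PJ; apply/seteqP; split=> //; apply: contrapT => JP.
  by apply: (Pmax J); [split|right].
have [IP Pid P1] := gP; have P0 := good0 _ gP.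
have [Qq PQ Qsub] := quasi_closure star Pid P0.
set Q := contract _ in Qq PQ Qsub.
have QP : Q = P.
  apply: maxP => //; split; [exact: subset_trans IP PQ|by case: Qq|].
  by move=> /Qsub.
rewrite QP in Qq; exists P; split=> //; split.
  by split=> //; apply/(proper_quasiP Qq).
move=> J [Jq JT] PJ; apply: maxP => //; split.
- exact: subset_trans PJ.
- by case: Jq.
- by apply/proper_quasiP.
Qed.

(** If D^star contained the inverses of all nonzero elements of D, it would be
    the whole quotient field.  So some a^-1 is missing, and then 1 is not in
    a D^star, which contains the star_f-closure of the ideal a D. *)
Lemma max_star_f_exists star : ~ trivial_semistar star ->
  exists P, max_star_f star P.
Proof.
move=> ntriv; pose DK := extend (setT : set D).
have DKb : Fbar DK by apply: extend_Fbar; case: setT_ideal.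
have [a [a0 aD]] : exists a : D, a != 0 /\ ~ star DK (a%:F)^-1.
  apply: contrapT => nex; apply: ntriv.
  have starDK x : star DK x.
    have [a [b [b0 ->]]] := fractionE x.
    have [/submoduleP[_ _ +] _] := semistar_Fbar star DKb; apply.
    by apply: contrapT => nb; apply: nex; exists b.
  move=> E Eb; apply/seteqP; split=> // x _.
  have [/submoduleP[_ _ EM] [y Ey y0]] := Eb.
  have yDK : scale y DK `<=` E.
    by move=> _ [_ [b _ <-] <-]; rewrite mulrC; exact: EM.
  have /(_ x) := @semistar_mono _ star _ _ (scale_Fbar y0 DKb) Eb yDK; apply.
  rewrite semistar_scale //; exists (y^-1 * x); first exact: starDK.
  by rewrite mulVKf.
have aF0 : a%:F != 0 :> K by rewrite tofrac_eq0.
pose I : set D := [set a * b | b in setT].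
have I0 : nonzero_ideal I by exists a => //; exists 1; rewrite ?mulr1.
have Iid : is_ideal I.
  apply/idealP; split; first by exists 0; rewrite ?mulr0.
  - by move=> _ _ [x _ <-] [y _ <-]; exists (x + y); rewrite ?mulrDr.
  - by move=> b _ [x _ <-]; exists (b * x); rewrite 1?mulrCA.
have [|P [Pmax _]] := @exists_max_star_f star I Iid I0; last by exists P.
move=> [F [Ff FI F1]]; apply: aD.
have : star (scale a%:F DK) 1.
  move: F1; apply: semistar_mono; [exact: fbold_Fbar|exact: scale_Fbar|].
  move=> x /FI[_ [b _ <-] <-]; exists b%:F; rewrite ?rmorphM //.
  exact/extendE.
rewrite semistar_scale // => -[x DKx ax].
by rewrite -[_^-1]mulr1 -ax mulKf.
Qed.

(** For a \notin P the ideal (P : a) contains P and is again a proper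
    quasi-star_f-ideal, because star commutes with multiplication by a.  By
    maximality it equals P, which says that a b \in P forces b \in P. *)
Lemma max_star_f_prime star P : max_star_f star P -> is_prime_ideal P.
Proof.
move=> [[Pq PT] Pmax]; have [Pid P0 Pcl] := Pq.
have /idealP[Pz PD PM] := Pid.
split.
  split=> [||a x y /set_mem Px /set_mem Py]; first exact: mem_set.
    by apply/negP => /set_mem P1; apply: PT; exact: ideal_unit.
  by apply: mem_set; apply: PD => //; exact: PM.
move=> a b /set_mem Pab; apply/orP.
have [/mem_set Pa|nPa] := pselect (P a); [by left|right; apply: mem_set].
have a0 : a != 0 by apply: contra_notN nPa => /eqP ->.
have aF0 : a%:F != 0 :> K by rewrite tofrac_eq0.
pose J : set D := [set x | P (a * x)].
have PJ : P `<=` J by move=> x; exact: PM.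
have <- : J = P; last by [].
have Jid : is_ideal J.
  apply/idealP; rewrite /J /=; split=> [|x y Jx Jy|c x Jx].
  - by rewrite mulr0.
  - by rewrite mulrDr; exact: PD.
  - by rewrite mulrCA; exact: PM.
have J0 : nonzero_ideal J by case: P0 => c Pc c0; exists c => //; exact: PJ.
apply: Pmax => //; split; last first.
  move=> JT; apply: nPa; have : J 1 by rewrite JT.
  by rewrite /J /= mulr1.
split=> //; apply/seteqP; split=> [x|x Jx]; last first.
  by apply: star_f_ext; [exact: extend_Fbar|exists x].
move=> [F [Ff FJ Fx]]; rewrite /J /= -Pcl /contract /= rmorphM.
exists (scale a%:F F); split; first exact: fbold_scale.
  move=> _ [_ /FJ[y Jy <-] <-]; rewrite -rmorphM; exact/extendE.
by rewrite semistar_scale //; [exists x%:F|exact: fbold_Fbar].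
Qed.

Lemma max_star_f_Pi star : max_star_f star `<=` Pi_star_f star.
Proof.
move=> P Pmax; have [[[_ P0 Pcl] PT] _] := Pmax.
by split=> //; [exact: max_star_f_prime Pmax|rewrite Pcl].
Qed.

(** * Centers of valuation overrings *)

Definition nonunits V : set K := [set x | V x /\ forall y, V y -> x * y != 1].

Lemma overringP V : overring (extend setT) V ->
  [/\ forall a : D, V a%:F, forall x y, V x -> V y -> V (x + y)
    & forall x y, V x -> V y -> V (x * y)].
Proof.
move=> [[_ VB VM] DV]; have VD a : V a%:F by apply: DV; exists a.
have /mem_set V0 := VD 0; rewrite rmorph0 in V0.
split=> // x y /mem_set Vx /mem_set Vy; apply: set_mem; last exact: VM.
have -> : x + y = x - (0 - y) by rewrite sub0r opprK.
by apply: (VB) => //; exact: VB.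
Qed.

Lemma nonunits_M V x y : overring (extend setT) V ->
  nonunits V x -> V y -> nonunits V (x * y).
Proof.
move=> /overringP[_ _ VM] [Vx nx] Vy; split; first exact: VM.
by move=> z Vz; rewrite -mulrA; apply: nx; exact: VM.
Qed.

Lemma nonunits_D V x y : valuation_overring V ->
  nonunits V x -> nonunits V y -> nonunits V (x + y).
Proof.
move=> [Vring Vval].
have [VF VD VM] := overringP Vring.
have V1 := VF 1; rewrite rmorph1 in V1.
(* The valuation property makes one of the two summands divide the other in V,
   and then it divides the sum. *)
have main u v : nonunits V v -> v != 0 -> V (u / v) -> nonunits V (u + v).
  move=> mv v0 Vuv; have -> : u + v = v * (u / v + 1).
    by rewrite mulrDr mulr1 mulrCA divff ?mulr1.
  by apply: nonunits_M => //; exact: VD.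
move=> mx my; have [->|y0] := eqVneq y 0; first by rewrite addr0.
have [->|x0] := eqVneq x 0; first by rewrite add0r.
have [|Vxy|Vyx] := Vval (x / y); first by rewrite mulf_neq0 ?invr_neq0.
  exact: main.
by rewrite addrC; apply: main => //; rewrite invf_div in Vyx.
Qed.

Lemma nonunits_submodule V : valuation_overring V -> is_submodule (nonunits V).
Proof.
move=> Vv; have [Vring _] := Vv; have [VF _ _] := overringP Vring.
apply/submoduleP; split; last 2 first.
- by move=> x y; exact: nonunits_D.
- by move=> a x mx; rewrite mulrC; exact: nonunits_M.
split; first by have := VF 0; rewrite rmorph0.
by move=> y _; rewrite mul0r eq_sym oner_eq0.
Qed.

(** An element of D outside the center of V is a unit of V. *)
Lemma localization_sub V P : valuation_overring V ->
  contract (nonunits V) `<=` P -> P 0 -> overring (localization P) V.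
Proof.
move=> [Vring Vval] cP P0; have [VF VD VM] := overringP Vring.
split; first by case: Vring.
move=> _ [a [s [nPs ->]]]; apply: VM => //.
have s0 : s%:F != 0 :> K.
  by rewrite tofrac_eq0; apply: contra_notN nPs => /eqP ->.
apply: contrapT => nVs; apply: nPs; apply: cP; split; first exact: VF.
move=> y Vy; apply: contra_notN nVs => /eqP sy.
by rewrite -[_^-1]mulr1 -sy mulKf.
Qed.

(** If F were contained in Q, then 1 would be in Q^star_f.  So F contains some
    a \notin Q, and 1 = a (1 / a) is in F D_Q. *)
Lemma star_tilde_one star F : fbold F -> F `<=` extend setT -> star F 1 ->
  star_tilde star F 1.
Proof.
move=> Ff FD F1 Q [[[Q0 _ _] _] _ QT].
have [a [Fa nQa]] : exists a, F a%:F /\ ~ Q a.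
  apply: contrapT => nex; apply: QT; apply/seteqP; split=> // b _.
  exists F; split=> //.
    move=> x Fx; have [a _ ax] := FD _ Fx; rewrite -ax in Fx *.
    by apply/extendE; apply: contrapT => nQa; apply: nex; exists a.
  rewrite -[b%:F]mulr1; have /submoduleP[_ _] := star_submodule star Ff.
  exact.
exists 1, (fun=> a%:F), (fun=> 1%:F / a%:F); split=> // [_|].
  by exists 1, a.
rewrite big_ord1 rmorph1 mulrC divfK // tofrac_eq0.
by apply: contra_notN nQa => /eqP ->; exact: set_mem.
Qed.

End SemistarTheory.

Theorem theorem3p9 (D : idomainType) (star : semistar D)
    (star_nontrivial : ~ trivial_semistar star)
    (V : set {fraction D}) (V_val : valuation_overring V) :
  star_valuation_overring (star_tilde star) V <->
  exists P : set D, max_star_f star P /\ overring (localization P) V.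
Proof.
split; last first.
  move=> [P [Pmax [_ PV]]]; split=> // F Ff x.
  move=> /(_ P (max_star_f_Pi Pmax))[n [a [b [Fa Pb ->]]]].
  by exists n, a, b; split=> // i; exact: PV.
move=> [_ Vtilde]; have [Vring _] := V_val.
have Mmod := nonunits_submodule V_val.
pose C := contract (nonunits V).
have Cid : is_ideal C by exact: contract_ideal.
have [C0|C0] := pselect (nonzero_ideal C); last first.
  have [P Pmax] := max_star_f_exists star_nontrivial.
  have [[[/idealP[P0 _ _] _ _] _] _] := Pmax.
  exists P; split=> //; apply: localization_sub => // a Ca.
  have [->//|a0] := eqVneq a 0; by case: C0; exists a.
have C1 : ~ star_f star (extend C) 1.
  move=> [F [Ff FC F1]].
  have FD : F `<=` extend setT by move=> x /FC; exact: extend_sub.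
  have [n [a [b [Fa Vb sum1]]]] := Vtilde F Ff _ (star_tilde_one Ff FD F1).
  have [V1 /(_ 1)] : nonunits V 1.
    rewrite sum1; apply: submodule_sum => // i; apply: nonunits_M => //.
    by have /FC[c Cc <-] := Fa i.
  by rewrite mulr1 eqxx => /(_ V1).
have [P [Pmax CP]] := exists_max_star_f Cid C0 C1.
exists P; split=> //; apply: localization_sub => //; apply: CP.
by have /idealP[] := Cid.
Qed.
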